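(* The star Menger property is not necessarily inherited by closed subsets, nor by closed $G_\delta$-subsets, nor by zero sets. That is: (i) there exist a star Menger space $X$ and a closed subset of $X$ which, as a subspace, is not star Menger; (ii) there exist a star Menger space $X$ and a closed $G_\delta$-subset of $X$ which is not star Menger; (iii) there exist a star Menger space $X$ and a zero set of $X$ which is not star Menger.
   Context: All spaces are assumed to be regular and $T_1$. For a family $\mathcal{U}$ of subsets of $X$ and $A\subseteq X$, $St(A,\mathcal{U})=\bigcup\{U\in\mathcal{U}:U\cap A\neq\emptyset\}$. A space $M$ is Menger if for every sequence $\{\mathcal{U}_n:n\in\omega\}$ of open covers of $M$ there are finite subcollections $\mathcal{V}_n\subseteq\mathcal{U}_n$ ($n\in\omega$) such that $\bigcup\{\mathcal{V}_n:n\in\omega\}$ is an open cover of $M$. A space $X$ is star Menger if for every open cover $\mathcal{U}$ of $X$ there is a subspace $M\subseteq X$ which is Menger and satisfies $St(M,\mathcal{U})=X$. A zero set of $X$ is a set of the form $f^{-1}(0)$ with $f:X\to\mathbb{R}$ continuous. *)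

(* Defs.v *)
From mathcomp Require Import all_boot all_order all_algebra.
From mathcomp Require Import all_classical all_reals topology normedtype.
From mathcomp Require Import borel_hierarchy.

Set Implicit Arguments.
Unset Strict Implicit.
Unset Printing Implicit Defensive.

Import numFieldNormedType.Exports.

Local Open Scope classical_set_scope.
Local Open Scope ring_scope.

Definition open_cover (X : topologicalType) (U : set (set X)) : Prop :=
  U `<=` open /\ \bigcup_(A in U) A = setT.

Definition star (X : Type) (A : set X) (U : set (set X)) : set X :=
  \bigcup_(B in [set B | U B /\ B `&` A !=set0]) B.

Definition menger (X : topologicalType) : Prop :=
  forall U : nat -> set (set X), (forall n, open_cover (U n)) ->
  exists V : nat -> set (set X),
    [/\ forall n, V n `<=` U n,
        forall n, finite_set (V n) &
        open_cover (\bigcup_n V n)].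

(* A set coerced to a type carries the subspace topology (the initial topology
   of the inclusion), unlike the library's [subspace], which keeps the ambient
   carrier and makes the points outside the set isolated. *)
Definition star_menger (X : topologicalType) : Prop :=
  forall U : set (set X), open_cover U ->
  exists M : set X, menger (set_type M) /\ star M U = setT.

Definition zero_set (R : realType) (X : topologicalType) (Z : set X) : Prop :=
  exists f : X -> R, continuous f /\ Z = f @^-1` [set 0].

(* Main.v *)
(** The space is the Cantor tree [2^<w] together with its branches [2^w]:
    nodes are isolated, and a neighbourhood of a branch contains almost all of
    its initial segments.  The countable set of nodes is dense, so every open
    cover is starred by it and the space is star Menger.  The branches form a
    discrete subspace of size continuum, which cannot be star Menger, and they
    are the zero set of the function vanishing on branches and equal to
    [1 / (n + 1)] on nodes of height [n]. *)
Require Import Defs.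
From mathcomp Require Import all_boot all_order all_algebra.
From mathcomp Require Import all_classical all_reals topology normedtype.
From mathcomp Require Import borel_hierarchy.
From HB Require Import structures.
From mathcomp Require Import interval_inference sequences.

Set Implicit Arguments.
Unset Strict Implicit.
Unset Printing Implicit Defensive.

Import Order.TTheory GRing.Theory Num.Theory numFieldNormedType.Exports.

Local Open Scope classical_set_scope.

(** The [n]-th cover only has to handle the point numbered [n] by the injection [f], so each
    selection has at most one member. *)
Lemma countable_menger (X : topologicalType) :
  countable [set: X] -> menger X.
Proof.
move=> /countable_injP[f finj] U Ucov.
have /choice[g gP] (nx : nat * X) : exists B, U nx.1 B /\ B nx.2.
  have [_ Ufull] := Ucov nx.1.
  have [B UB Bx] : (\bigcup_(A in U nx.1) A) nx.2 by rewrite Ufull.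
  by exists B.
exists (fun n => [set g (n, x) | x in [set x | f x = n]]); split.
- by move=> n _ [x _ <-]; exact: (gP (n, x)).1.
- move=> n; apply: finite_image; have [[x fx]|nex] := pselect (exists x, f x = n).
    apply: sub_finite_set (finite_set1 x) => y /= fy.
    by apply: finj; rewrite ?inE // fx fy.
  apply: sub_finite_set (finite_set0 X) => y /= fy.
  by apply: nex; exists y.
- split=> [_ [n _ [x _ <-]]|]; first exact: (Ucov n).1 _ (gP (n, x)).1.
  apply/seteqP; split=> // x _; exists (g (f x, x)); last exact: (gP (f x, x)).2.
  by exists (f x) => //; exists x.
Qed.

Lemma countable_set_type (T : Type) (A : set T) :
  countable A -> countable [set: set_type A].
Proof.
move=> /countable_injP[f finj]; apply/countable_injP.
exists (fun a => f (val a)) => a b _ _ fab; apply: val_inj.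
by apply: finj => //; exact: valP.
Qed.

Lemma countable_dense_star_menger (X : topologicalType) (D : set X) :
  countable D -> dense D -> star_menger X.
Proof.
move=> Dcount Ddense U [Uopen Ufull]; exists D; split.
  exact/countable_menger/countable_set_type.
apply/seteqP; split=> // x _.
have [B UB Bx] : (\bigcup_(A in U) A) x by rewrite Ufull.
by exists B => //; split=> //; apply: Ddense; [exists x | exact: Uopen].
Qed.

(* Covering by singletons forces the Menger set to be the whole space, and then
   writes it as a countable union of finite sets. *)
Lemma discrete_star_menger_countable (X : topologicalType) :
  (forall x : X, open [set x]) -> star_menger X -> countable [set: X].
Proof.
move=> Xdiscr /(_ (range set1))[].
  split=> [_ [x _ <-] //|]; apply/seteqP; split=> // x _.
  by exists [set x] => //; exists x.
move=> M [Mmenger starM].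
have MT x : M x.
  have : star M (range set1) x by rewrite starM.
  by move=> [_ [[y _ <-] [z [->]]]] My ->.
have [|V [Vsub Vfin [_ Vfull]]] :=
    Mmenger (fun=> [set (val : M -> X) @^-1` [set x] | x in [set: X]]).
  move=> _; split=> [_ [x _ <-]|]; first by exists [set x].
  apply/seteqP; split=> // a _.
  by exists (val @^-1` [set val a]) => //; exists (val a).
pose W n := [set x : X | V n ((val : M -> X) @^-1` [set x])].
(* Since [M] is everything, these preimages are nonempty and hence distinct; finiteness of [V n]
   thus passes to [W n]. *)
have Vinj : injective (fun x : X => (val : M -> X) @^-1` [set x]).
  move=> x y /seteqP[/(_ (exist _ x (mem_set (MT x)))) /= xy _].
  exact: xy.
suff -> : [set: X] = \bigcup_n W n.
  apply: bigcup_countable => // n _; apply: finite_set_countable.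
  apply: (@finite_preimage _ _ (V n) (fun x : X => (val : M -> X) @^-1` [set x])).
    by move=> x y _ _; exact: Vinj.
  exact: Vfin.
apply/seteqP; split=> // x _.
have [B [n _ VB] Bx] : (\bigcup_(A in \bigcup_n V n) A)
    (exist _ x (mem_set (MT x)) : M) by rewrite Vfull.
exists n => //; rewrite /W /=.
by have [y _ yB] := Vsub _ _ VB; move: Bx VB; rewrite -yB /= => ->.
Qed.

(** Cantor's diagonal argument: [g] negates at [n] the sequence coded by [n], which is contradictory
    at its own code [f g]. *)
Lemma uncountable_nat_bool : ~ countable [set: nat -> bool].
Proof.
move=> /countable_injP[f finj].
pose g n := `[< exists x, f x = n /\ ~~ x n >].
have : g (f g) <-> ~~ g (f g).
  split=> [/asboolP[x [fx]]|ngg]; last by apply/asboolP; exists g.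
  by have -> // : x = g by apply: finj; rewrite ?inE.
by case: (g (f g)) => -[gT gF]; [have := gT isT | have := gF isT].
Qed.

Section ZeroSets.
Variables (R : realType) (X : topologicalType) (Z : set X).

Lemma zero_set_closed : zero_set R Z -> closed Z.
Proof.
by move=> [f [fcont ->]]; apply: closed_comp => [x _|]; [exact: fcont | exact: closed_eq].
Qed.

Lemma zero_set_Gdelta : zero_set R Z -> Gdelta Z.
Proof.
move=> [f [fcont ->]].
exists (fun n => f @^-1` [set r | `|r| < n.+1%:R^-1]%R) => [n|].
  apply: open_comp => [x _|]; first exact: fcont.
  apply: (@open_comp _ _ (fun r : R => `|r|%R) [set r | r < n.+1%:R^-1]%R).
    by move=> r _; exact: norm_continuous.
  exact: open_lt.
apply/seteqP; split=> [x /= fx n _ /=|x /= fx].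
  by rewrite fx normr0 invr_gt0 ltr0n.
(* By the Archimedean property, a positive [|f x|] would exceed some [1 / (n + 1)]. *)
apply/eqP; rewrite -normr_le0 leNgt; apply/negP => fx_gt0.
have [n _ /(_ n (leqnn n))/= ltn] := near_infty_natSinv_lt (PosNum fx_gt0).
by have := lt_trans (fx n I) ltn; rewrite ltxx.
Qed.

End ZeroSets.

Inductive cantor_tree : Type := Node of seq bool | Branch of (nat -> bool).

HB.instance Definition _ := gen_eqMixin cantor_tree.
HB.instance Definition _ := gen_choiceMixin cantor_tree.

(** This is the Mrowka Psi-space of the almost disjoint family of branches, each seen as the set of
    its initial segments [mkseq x n]. *)
Definition cantor_tree_open (U : set cantor_tree) : Prop :=
  forall x, U (Branch x) -> \forall n \near \oo, U (Node (mkseq x n)).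

Lemma cantor_tree_openT : cantor_tree_open setT.
Proof. by move=> x _; exists 0%N. Qed.

Lemma cantor_tree_openI : setI_closed cantor_tree_open.
Proof. by move=> U V oU oV x [/oU Ux /oV Vx]; exact: filterI. Qed.

Lemma cantor_tree_open_bigU (I : Type) (F : I -> set cantor_tree) :
  (forall i, cantor_tree_open (F i)) -> cantor_tree_open (\bigcup_i F i).
Proof.
by move=> oF x [i _ /oF]; apply: filterS => n Fn; exists i.
Qed.

HB.instance Definition _ := isOpenTopological.Build cantor_tree
  cantor_tree_openT cantor_tree_openI cantor_tree_open_bigU.

Lemma cantor_tree_openE (U : set cantor_tree) : open U = cantor_tree_open U.
Proof. by []. Qed.

Lemma cantor_tree_closed1 (a : cantor_tree) : closed [set a].
Proof.
rewrite -openC cantor_tree_openE => x ax; case: a ax => [s|y] _.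
  (* Initial segments longer than [s] differ from [s]. *)
  by exists (size s).+1 => // n /= + [sn]; rewrite -sn size_mkseq ltnn.
by exists 0%N.
Qed.

Lemma branches_zero_set (R : realType) : zero_set R (range Branch).
Proof.
(* The successor keeps the root, of size 0, out of the zero set: the inverse of 0 is 0 by
   convention. *)
exists (fun a => if a is Node s then (size s).+1%:R^-1 else 0)%R; split.
  apply/continuousP => A oA; rewrite cantor_tree_openE => x /= A0.
  (* Only branches need a check, and along the initial segments of a branch the values form the
     harmonic sequence. *)
  have [N _ AN] := @cvg_harmonic R A (open_nbhs_nbhs (conj oA A0)).
  by exists N => // n /AN /=; rewrite size_mkseq.
apply/seteqP; split=> [_ [x _ <-] //|[s|x] /= a0]; last by exists x.
by move/eqP: a0; rewrite invr_eq0 pnatr_eq0.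
Qed.

Lemma cantor_tree_accessible : accessible_space cantor_tree.
Proof.
move=> a b ab; exists (~` [set b]); split; rewrite ?inE.
- exact/closed_openC/cantor_tree_closed1.
- exact/eqP.
- by move=> /(_ erefl).
Qed.

Lemma cantor_tree_regular : regular_space cantor_tree.
Proof.
move=> a A; rewrite nbhsE => -[U [oU Ua] UA].
(* A clopen neighbourhood equals its closure, so regularity follows from a base of clopen sets. *)
suff [B [oB cB Ba BU]] : exists B, [/\ open B, closed B, B a & B `<=` U].
  by exists B; [exists B | have <- := (closure_id B).1 cB; exact: subset_trans UA].
case: a Ua => [s|x] Ux.
  exists [set Node s]; split=> //; last by move=> _ ->.
  exact: cantor_tree_closed1.
have [N _ NU] := oU _ Ux.
exists (Branch x |` [set Node (mkseq x n) | n in [set n | (N <= n)%N]]).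
split; last 2 first.
- by left.
- by move=> _ [->//|[n Nn <-]]; exact: NU.
- rewrite cantor_tree_openE => y [[->]|[]//].
  by exists N => // n Nn; right; exists n.
rewrite -openC cantor_tree_openE => y yB.
(* Almost disjointness: once [x] and [y] differ at [k], no initial segment of [y] of length above
   [k] is one of [x]. *)
have [k xyk] : exists k, x k <> y k.
  apply/existsNP => xy; apply: yB; left; congr Branch.
  by apply/funext => k; rewrite xy.
exists k.+1 => // n /= kn [//|[m _ [xym]]].
have mn : m = n by rewrite -(size_mkseq x m) xym size_mkseq.
apply: xyk; rewrite -(nth_mkseq false x kn) -(nth_mkseq false y kn).
by rewrite -xym mn.
Qed.

Lemma cantor_tree_star_menger : star_menger cantor_tree.
Proof.
apply: (@countable_dense_star_menger _ (range Node)).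
  exact/(card_le_trans (card_image_le _ _))/countableP.
move=> U [[s|x] Ux] oU; first by exists (Node s); split=> //; exists s.
have [n _ /(_ n (leqnn n)) Un] := oU _ Ux.
by exists (Node (mkseq x n)); split=> //; exists (mkseq x n).
Qed.

Lemma branches_not_star_menger : ~ star_menger (set_type (range Branch)).
Proof.
move=> /discrete_star_menger_countable Bcount; apply: uncountable_nat_bool.
have {Bcount}/countable_injP[f finj] : countable [set: set_type (range Branch)].
  apply: Bcount => a; have [x _ xa] := set_valP a.
  (* Adding all nodes makes the set open, while its trace on the branches is still one point. *)
  exists (Branch x |` range Node).
    rewrite cantor_tree_openE => y _; exists 0%N => // n _.
    by right; exists (mkseq y n).
  apply/seteqP; split=> [b|_ ->]; last by left.
  have [y _ yb] := set_valP b => -[bx|[s _ sb]].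
    by apply: val_inj; rewrite -[val b]/(set_val b) bx xa.
  by have := etrans sb (esym yb).
apply/countable_injP.
have inB x : Branch x \in range Branch by rewrite inE; exists x.
exists (fun x => f (exist _ (Branch x) (inB x))) => x y _ _ fxy.
have /(congr1 val)[] // := finj _ _ (in_setT _) (in_setT _) fxy.
Qed.

Theorem proposition4p1 (R : realType) :
  [/\ exists X : topologicalType,
        [/\ regular_space X, accessible_space X & star_menger X] /\
        exists F : set X, closed F /\ ~ star_menger (set_type F),
      exists X : topologicalType,
        [/\ regular_space X, accessible_space X & star_menger X] /\
        exists F : set X,
          [/\ closed F, Gdelta F & ~ star_menger (set_type F)] &
      exists X : topologicalType,
        [/\ regular_space X, accessible_space X & star_menger X] /\
        exists Z : set X, zero_set R Z /\ ~ star_menger (set_type Z)].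
Proof.
have treeP : [/\ regular_space cantor_tree, accessible_space cantor_tree
                & star_menger cantor_tree].
  split; [exact: cantor_tree_regular | exact: cantor_tree_accessible |].
  exact: cantor_tree_star_menger.
(* One subset settles all three items: a zero set is closed and a [Gdelta]. *)
have Z0 := branches_zero_set R.
have Zcl := zero_set_closed Z0.
have Zn := branches_not_star_menger.
split; exists cantor_tree; split=> //; exists (range Branch); split=> //.
exact: zero_set_Gdelta Z0.
Qed.
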